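(* Let $X$ be a (complex) Banach lattice, let $T\in B(X)$ be a positive operator and let $\beta\ge1$. Then the following are equivalent: (1) $T$ is $C_1^{(\beta)}$-bounded. (2) $T$ is uniformly $\beta$-Kreiss bounded. (3) $T$ is $\beta$-Kreiss bounded.
   Context: $\mathbb{N}=\{1,2,\dots\}$; $\mathbb{D}$ is the open unit disk; $R(\lambda,T)=(\lambda I-T)^{-1}$; $S_n^1(T):=\sum_{j=0}^n T^j$. $T$ is $C_1^{(\beta)}$-bounded if there is $C>0$ with $\|S_n^1(T)\|\le C n^{\beta}$ for all $n\in\mathbb{N}$. $T$ is uniformly $\beta$-Kreiss bounded if there is $C>0$ such that $\Big\|\sum_{j=0}^n\frac{T^j}{\lambda^{j+1}}\Big\|\le\frac{C}{(|\lambda|-1)^{\beta}}$ for all $1<|\lambda|<2$ and $n\in\mathbb{N}$. $T$ is $\beta$-Kreiss bounded if $\sigma(T)\subset\overline{\mathbb{D}}$ and there is $C>0$ with $\|R(\lambda,T)\|\le\frac{C}{(|\lambda|-1)^{\beta}}$ for all $1<|\lambda|<2$. *)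

(* Defs.v *)
From mathcomp Require Import all_boot all_order all_algebra.
From mathcomp Require Import complex.
From mathcomp Require Import all_classical all_reals all_analysis.

Set Implicit Arguments.
Unset Strict Implicit.
Unset Printing Implicit Defensive.

Import Order.TTheory GRing.Theory Num.Theory.
Import numFieldNormedType.Exports.

Local Open Scope classical_set_scope.
Local Open Scope ring_scope.
Local Open Scope complex_scope.

(** * Banach lattices *)

Definition is_lub (E : Type) (le : E -> E -> Prop) (A : set E) (m : E) : Prop :=
  (forall x, A x -> le x m) /\ (forall b, (forall x, A x -> le x b) -> le m b).

(** Meets are [- ((- x) \/ (- y))], so that they need not be required.  The order
    is kept as a field of a record because the hierarchy has no structure that
    joins an order and a norm below [numDomainType]. *)
Record banachLattice (R : realType) := BanachLattice {
  bl_sort :> completeNormedModType R ;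
  bl_le : bl_sort -> bl_sort -> Prop ;
  bl_join : bl_sort -> bl_sort -> bl_sort ;
  bl_le_refl : forall x, bl_le x x ;
  bl_le_anti : forall x y, bl_le x y -> bl_le y x -> x = y ;
  bl_le_trans : forall x y z, bl_le x y -> bl_le y z -> bl_le x z ;
  bl_leD2r : forall x y z, bl_le x y -> bl_le (x + z) (y + z) ;
  bl_leZ : forall (a : R) x, 0 <= a -> bl_le 0 x -> bl_le 0 (a *: x) ;
  bl_joinP : forall x y, is_lub bl_le [set x; y] (bl_join x y) ;
  bl_norm_le : forall x y,
    bl_le (bl_join x (- x)) (bl_join y (- y)) -> `|x| <= `|y|
}.

(** [m] is the modulus of [x + i y]:
    it is the supremum over [t] of [Re (e^{-it} (x + i y))]. *)
Definition is_modulus (R : realType) (E : banachLattice R) (x y m : E) : Prop :=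
  is_lub (@bl_le R E) [set cos t *: x + sin t *: y | t in [set: R]] m.

(** A complex Banach lattice is the complexification [E + iE] of a real Banach
    lattice [E], normed by [||z|| = || |z| ||].  It is given here up to
    isomorphism, by the embedding of [E] as its real part.  The supremum defining
    the modulus always exists in a Banach lattice, so that its existence in
    [cbl_normE] is not an additional requirement. *)
Record complexBanachLattice (R : realType) := ComplexBanachLattice {
  cbl_sort :> completeNormedModType R[i] ;
  cbl_real : banachLattice R ;
  cbl_embed : cbl_real -> cbl_sort ;
  cbl_embedD : forall x y, cbl_embed (x + y) = cbl_embed x + cbl_embed y ;
  cbl_embedZ : forall (a : R) x, cbl_embed (a *: x) = a%:C *: cbl_embed x ;
  cbl_decomp : bijective (fun p : cbl_real * cbl_real =>
    cbl_embed p.1 + 'i *: cbl_embed p.2) ;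
  cbl_normE : forall x y : cbl_real, exists2 m : cbl_real, is_modulus x y m &
    `|cbl_embed x + 'i *: cbl_embed y| = `|m|%:C
}.

Definition positive_op (R : realType) (X : complexBanachLattice R)
    (T : X -> X) : Prop :=
  forall x : cbl_real X, bl_le 0 x ->
    exists2 y : cbl_real X, bl_le 0 y & T (cbl_embed x) = cbl_embed y.

(** * Bounded operators *)

(** Norms over [R[i]] take their values in [R[i]]; [rnorm] is the same norm
    with values in [R]. *)
Definition rnorm (R : realType) (V : normedZmodType R[i]) (v : V) : R :=
  complex.Re `|v|.

(** Only meaningful for bounded operators: the [sup] of an unbounded set of
    reals is [0]. *)
Definition opnorm (R : realType) (X : normedModType R[i]) (A : X -> X) : R :=
  sup [set rnorm (A x) | x in [set x : X | rnorm x <= 1]].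

Definition is_resolvent (R : realType) (X : normedModType R[i])
    (T : {linear X -> X}) (l : R[i]) (S : X -> X) : Prop :=
  [/\ linear S, continuous S,
      forall x, S (l *: x - T x) = x
    & forall x, l *: S x - T (S x) = x].

Definition spectrum (R : realType) (X : normedModType R[i])
    (T : {linear X -> X}) : set R[i] :=
  [set l | ~ exists S, is_resolvent T l S].

(** Equal to [(l I - T)^-1] if [l] is not in the spectrum, to [0] otherwise. *)
Definition resolvent (R : realType) (X : normedModType R[i])
    (T : {linear X -> X}) (l : R[i]) : X -> X :=
  xget (fun=> 0) [set S | is_resolvent T l S].

(** * Growth and resolvent conditions *)

Definition C1_bounded (R : realType) (X : normedModType R[i]) (beta : R)
    (T : {linear X -> X}) : Prop :=
  exists2 C : R, 0 < C & forall n : nat, (0 < n)%N ->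
    opnorm (fun x => \sum_(0 <= j < n.+1) iter j T x) <= C * n%:R `^ beta.

Definition uniformly_Kreiss_bounded (R : realType) (X : normedModType R[i])
    (beta : R) (T : {linear X -> X}) : Prop :=
  exists2 C : R, 0 < C & forall (l : R[i]) (n : nat),
    1 < rnorm l < 2 -> (0 < n)%N ->
    opnorm (fun x => \sum_(0 <= j < n.+1) (l ^+ j.+1)^-1 *: iter j T x)
      <= C / (rnorm l - 1) `^ beta.

Definition Kreiss_bounded (R : realType) (X : normedModType R[i])
    (beta : R) (T : {linear X -> X}) : Prop :=
  spectrum T `<=` [set l | rnorm l <= 1] /\
  exists2 C : R, 0 < C & forall l : R[i], 1 < rnorm l < 2 ->
    opnorm (resolvent T l) <= C / (rnorm l - 1) `^ beta.

(* Main.v *)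
(** (1) => (2): the modulus satisfies |sum c_j T^j z| <= sum |c_j| T^j |z|, so it
    suffices to treat positive vectors and l = r > 1; summation by parts then
    reduces the claim to n^beta <= K (r - 1)^(-beta) r^(n/2).
    (2) => (3): the hypothesis forces the growth of T^n to be at most rho^n for every
    rho > 1, so the Neumann series converges and its partial sums bound the resolvent.
    (3) => (1): for real r > 1 the resolvent R(r,T) is positive. This holds for large
    r, and positivity propagates downwards with a step controlled by the norm of the
    resolvent, hence down to any r > 1. Then sum_(j <= n) T^j x <= r^(n+1) R(r,T) x
    for x >= 0, and r = 1 + 1/(n+1) gives the bound. *)

From HB Require Import structures.
Require Import Defs.
From mathcomp Require Import all_boot all_order all_algebra.
From mathcomp Require Import complex.
From mathcomp Require Import all_classical all_reals all_analysis.
From mathcomp Require Import ring lra.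

Set Implicit Arguments.
Unset Strict Implicit.
Unset Printing Implicit Defensive.

Import Order.TTheory GRing.Theory Num.Theory.
Import numFieldNormedType.Exports.

Local Open Scope classical_set_scope.
Local Open Scope ring_scope.

(** * Order and norm in real Banach lattices *)

Section BanachLatticeTheory.
Context (R : realType) (E : banachLattice R).
Implicit Types (x y z m : E) (a : R).

Local Notation le := (@bl_le R E).

Definition bl_abs x : E := bl_join x (- x).

(** The negative part of [x]. Positivity of a vector is proved below by showing that this part
    vanishes. *)
Definition bl_neg x : E := bl_join (- x) 0.

Lemma bl_subr_ge0 x y : le 0 (y - x) <-> le x y.
Proof.
split=> h; first by have := bl_leD2r x h; rewrite add0r subrK.
by have := bl_leD2r (- x) h; rewrite subrr.
Qed.

Lemma bl_leD x y z w : le x y -> le z w -> le (x + z) (y + w).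
Proof.
move=> xy zw; apply: (bl_le_trans (bl_leD2r z xy)).
by rewrite [y + z]addrC [y + w]addrC; apply: bl_leD2r.
Qed.

Lemma bl_addr_ge0 x y : le 0 x -> le 0 y -> le 0 (x + y).
Proof. by move=> x0 y0; have := bl_leD x0 y0; rewrite addr0. Qed.

Lemma bl_leN x y : le x y -> le (- y) (- x).
Proof. by move=> /bl_subr_ge0 h; apply/bl_subr_ge0; rewrite opprK addrC. Qed.

Lemma bl_oppr_le0 x : le 0 x -> le (- x) 0.
Proof. by move=> /bl_leN; rewrite oppr0. Qed.

Lemma bl_ler_wpZ2l a x y : 0 <= a -> le x y -> le (a *: x) (a *: y).
Proof.
move=> a0 /bl_subr_ge0 h; apply/bl_subr_ge0.
by rewrite -scalerBr; apply: bl_leZ.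
Qed.

Lemma bl_ler_wpZ2r a b x : a <= b -> le 0 x -> le (a *: x) (b *: x).
Proof.
move=> ab x0; apply/bl_subr_ge0; rewrite -scalerBl; apply: bl_leZ => //.
by rewrite subr_ge0.
Qed.

Lemma bl_sumr_ge0 (I : Type) (r : seq I) (F : I -> E) :
  (forall i, le 0 (F i)) -> le 0 (\sum_(i <- r) F i).
Proof.
move=> F0; elim/big_ind: _ => //; [exact: bl_le_refl | exact: bl_addr_ge0].
Qed.

Lemma bl_ler_sum (I : Type) (r : seq I) (F G : I -> E) :
  (forall i, le (F i) (G i)) -> le (\sum_(i <- r) F i) (\sum_(i <- r) G i).
Proof.
move=> FG; apply/bl_subr_ge0; rewrite -sumrB.
by apply: bl_sumr_ge0 => i; apply/bl_subr_ge0.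
Qed.

Lemma bl_ge0_double x : le 0 (x + x) -> le 0 x.
Proof.
have half0 : 0 <= 2^-1 :> R by rewrite invr_ge0 ler0n.
move=> /(bl_leZ half0).
by rewrite -mulr2n -(scaler_nat 2 x) scalerA mulVf ?pnatr_eq0// scale1r.
Qed.

Lemma bl_le_abs x : le x (bl_abs x).
Proof. by have [h _] := bl_joinP x (- x); apply: h; left. Qed.

Lemma bl_leN_abs x : le (- x) (bl_abs x).
Proof. by have [h _] := bl_joinP x (- x); apply: h; right. Qed.

Lemma bl_abs_le x y : le x y -> le (- x) y -> le (bl_abs x) y.
Proof.
move=> xy nxy; have [_ h] := bl_joinP x (- x).
by apply: h => _ [|] ->.
Qed.

Lemma bl_ge0_bound x y : le x y -> le (- x) y -> le 0 y.
Proof. by move=> h1 h2; apply: bl_ge0_double; have := bl_leD h1 h2; rewrite subrr. Qed.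

Lemma bl_ger0_abs x : le 0 x -> bl_abs x = x.
Proof.
move=> x0; apply: bl_le_anti; last exact: bl_le_abs.
apply: bl_abs_le; first exact: bl_le_refl.
exact: bl_le_trans (bl_oppr_le0 x0) x0.
Qed.

Lemma bl_abs_ge0 x : le 0 (bl_abs x).
Proof. by apply: bl_ge0_bound; [apply: bl_le_abs | apply: bl_leN_abs]. Qed.

Lemma bl_norm_abs x : `|bl_abs x| = `|x|.
Proof.
have e : bl_abs (bl_abs x) = bl_abs x by rewrite bl_ger0_abs//; apply: bl_abs_ge0.
apply/eqP; rewrite eq_le; apply/andP; split; apply: bl_norm_le;
  by rewrite -/(bl_abs x) -/(bl_abs (bl_abs x)) e; apply: bl_le_refl.
Qed.

Lemma bl_norm_dom x y : le x y -> le (- x) y -> `|x| <= `|y|.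
Proof.
move=> h1 h2; apply: bl_norm_le.
rewrite -[bl_join y _]/(bl_abs y) bl_ger0_abs; first exact: bl_abs_le.
exact: bl_ge0_bound h1 h2.
Qed.

Lemma bl_ler_norm x y : le 0 x -> le x y -> `|x| <= `|y|.
Proof.
move=> x0 xy; apply: bl_norm_dom => //.
exact: bl_le_trans (bl_oppr_le0 x0) (bl_le_trans x0 xy).
Qed.

Lemma bl_neg_ge0 x : le 0 (bl_neg x).
Proof. by have [h _] := bl_joinP (- x) 0; apply: h; right. Qed.

Lemma bl_addr_neg_ge0 x : le 0 (x + bl_neg x).
Proof.
have [h _] := bl_joinP (- x) 0.
by have /bl_subr_ge0 := h (- x) (or_introl erefl); rewrite opprK addrC.
Qed.

Lemma bl_neg_le x y : le 0 y -> le 0 (x + y) -> le (bl_neg x) y.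
Proof.
move=> y0 xy; have [_ h] := bl_joinP (- x) 0.
by apply: h => _ [|] -> //; apply/bl_subr_ge0; rewrite opprK addrC.
Qed.

Lemma bl_neg_eq0 x : bl_neg x = 0 -> le 0 x.
Proof. by move=> e; have := bl_addr_neg_ge0 x; rewrite e addr0. Qed.

(** The angle [acos s] has cosine [s] and sine |t|; it or its opposite realises the point [(s, t)],
    according to the sign of [t]. *)
Lemma bl_comb_le x y m s t : (forall r : R, le (cos r *: x + sin r *: y) m) ->
  s ^+ 2 + t ^+ 2 = 1 -> le (s *: x + t *: y) m.
Proof.
move=> hm st.
have s1 : -1 <= s <= 1.
  by rewrite -ler_norml -(@ler_pXn2r _ 2)// ?nnegrE// expr1n real_normK ?num_real//
    -st lerDl sqr_ge0.
have sE : cos (acos s) = s by apply: acosK; rewrite in_itv.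
have tE : sin (acos s) = `|t|.
  by rewrite sin_acos// -st addrC addKr sqrtr_sqr.
have [t0|t0] := leP 0 t.
  by have := hm (acos s); rewrite sE tE ger0_norm.
by have := hm (- acos s); rewrite cosN sinN sE tE ltr0_norm// opprK.
Qed.

Lemma is_modulus_ge0 x y m : is_modulus x y m -> le 0 m.
Proof.
case=> h _; apply: (@bl_ge0_bound x).
  by have := h _ (ex_intro2 _ _ 0 I erefl); rewrite cos0 sin0 scale1r scale0r addr0.
have := h _ (ex_intro2 _ _ pi I erefl).
by rewrite cospi sinpi scale0r addr0 scaleN1r.
Qed.

(** This is Re (c z) <= |c| |z| in real coordinates. It follows by rescaling [(s, t)] to the unit
    circle, except for [r = 0], which forces [s = t = 0]. *)
Lemma is_modulus_comb_le x y m r s t : is_modulus x y m -> 0 <= r ->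
  s ^+ 2 + t ^+ 2 = r ^+ 2 -> le (s *: x + t *: y) (r *: m).
Proof.
move=> hm; rewrite le_eqVlt => /predU1P[<-|r0].
  rewrite expr0n/= => /eqP; rewrite paddr_eq0 ?sqr_ge0// !sqrf_eq0.
  by move=> /andP[/eqP -> /eqP ->]; rewrite !scale0r addr0; apply: bl_le_refl.
move=> st; have h : le ((s / r) *: x + (t / r) *: y) m.
  apply: bl_comb_le; first by move=> u; case: hm => h _; apply: h; exists u.
  by rewrite !exprMn -mulrDl st -exprMn mulfV ?gt_eqF// expr1n.
have := bl_ler_wpZ2l (ltW r0) h.
by rewrite scalerDr !scalerA ![r * _]mulrC !divfK ?gt_eqF.
Qed.

Lemma is_modulus_real_norm x m : is_modulus x 0 m -> `|m| = `|x|.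
Proof.
move=> hm; have m0 := is_modulus_ge0 hm.
apply/eqP; rewrite eq_le; apply/andP; split.
  rewrite -(bl_norm_abs x); apply: bl_ler_norm => //.
  case: hm => _; apply=> _ [t _ <-]; rewrite scaler0 addr0.
  have h := @bl_leZ _ E ((1 + cos t) / 2) (bl_abs x - x).
  have k := @bl_leZ _ E ((1 - cos t) / 2) (bl_abs x + x).
  (* As cos t lies in [-1, 1], cos t x is the convex combination of x and -x with weights (1 + cos
     t)/2 and (1 - cos t)/2, and |x| dominates both vectors. *)
  apply/bl_subr_ge0.
  have -> : bl_abs x - cos t *: x =
     ((1 + cos t) / 2) *: (bl_abs x - x) + ((1 - cos t) / 2) *: (bl_abs x + x).
    rewrite !scalerDr addrACA -scalerDl scalerN [- _ + _]addrC -scalerBl.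
    have -> : (1 + cos t) / 2 + (1 - cos t) / 2 = 1 :> R by field.
    have -> : (1 - cos t) / 2 - (1 + cos t) / 2 = - cos t :> R by field.
    by rewrite scale1r scaleNr.
  apply: bl_addr_ge0.
    apply: h; first by have := cos_geN1 t; lra.
    by apply/bl_subr_ge0; apply: bl_le_abs.
  apply: k; first by have := cos_le1 t; lra.
  by have /bl_subr_ge0 := bl_leN_abs x; rewrite opprK.
apply: bl_norm_dom.
  have := @is_modulus_comb_le _ _ _ 1 1 0 hm ler01.
  by rewrite !scale1r scale0r addr0; apply; rewrite expr1n expr0n addr0.
have := @is_modulus_comb_le _ _ _ 1 (-1) 0 hm ler01.
by rewrite scale1r scale0r addr0 scaleN1r; apply; rewrite sqrrN expr1n expr0n addr0.
Qed.

End BanachLatticeTheory.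

(** * Iterates of a linear map *)

Section Iterates.
Context (K : fieldType) (V : lmodType K) (T : {linear V -> V}).
Implicit Types (a r : K) (x y : V).

Lemma linear_iterP n a x y : iter n T (a *: x + y) = a *: iter n T x + iter n T y.
Proof. by elim: n => //= n ->; rewrite linearP. Qed.

Lemma linear_iter0 n : iter n T 0 = 0.
Proof. by elim: n => //= n ->; rewrite linear0. Qed.

Lemma linear_iterZ n a x : iter n T (a *: x) = a *: iter n T x.
Proof. by have := linear_iterP n a x 0; rewrite linear_iter0 !addr0. Qed.

Lemma linear_iterD n x y : iter n T (x + y) = iter n T x + iter n T y.
Proof. by have := linear_iterP n 1 x y; rewrite !scale1r. Qed.

Lemma linear_iterB n x y : iter n T (x - y) = iter n T x - iter n T y.
Proof. by rewrite linear_iterD -scaleN1r linear_iterZ scaleN1r. Qed.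

(** The j-th summand equals r^(-j) T^j x - r^(-j-1) T^(j+1) x. *)
Lemma neumann_telescope n r x : r != 0 ->
  \sum_(j < n) (r ^+ j.+1)^-1 *: iter j T (r *: x - T x)
    = x - (r ^+ n)^-1 *: iter n T x.
Proof.
move=> r0; elim: n => [|n IH].
  by rewrite big_ord0 expr0 invr1 scale1r subrr.
have rE : (r ^+ n)^-1 = (r ^+ n.+1)^-1 * r by rewrite exprSr invfM divfK.
rewrite big_ord_recr /= IH rE linear_iterB linear_iterZ.
by rewrite scalerBr scalerA -iterSr addrA subrK.
Qed.

End Iterates.

(** * Positivity of the resolvent of a positive operator *)

Section PositiveOperatorTheory.
Context (R : realType) (E : banachLattice R) (T : {linear E -> E}).
Hypothesis T_ge0 : forall x, bl_le 0 x -> bl_le 0 (T x).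
Implicit Types (x y u v : E) (lam mu r : R).

Local Notation le := (@bl_le R E).

(** Positivity of (mu - T)^-1, put as an implication so that it makes sense before mu - T is known
    to be invertible. It already gives injectivity on the cone's differences when applied to y and
    -y. *)
Definition inverse_positive mu := forall y, le 0 (mu *: y - T y) -> le 0 y.

Lemma iter_ge0 n x : le 0 x -> le 0 (iter n T x).
Proof. by move=> x0; elim: n => //= n; apply: T_ge0. Qed.

(** Adding T (y + y^-) >= 0 to mu y - T y >= 0 gives mu y + T y^- >= 0, so y^- <= mu^-1 T y^-.
    Taking norms, M < mu forces y^- = 0. *)
Lemma inverse_positive_large M mu : (forall x, `|T x| <= M * `|x|) ->
  0 < mu -> M < mu -> inverse_positive mu.
Proof.
move=> TM mu0 Mmu y hy; apply: bl_neg_eq0; set w := bl_neg y.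
have w0 : le 0 w by apply: bl_neg_ge0.
have imu0 : 0 <= mu^-1 by rewrite invr_ge0 ltW.
have wT : le w (mu^-1 *: T w).
  apply: bl_neg_le; first by apply: bl_leZ => //; apply: T_ge0.
  have : le 0 (mu *: y + T w).
    have := bl_addr_ge0 hy (T_ge0 (bl_addr_neg_ge0 y)).
    by rewrite linearD addrA subrK.
  by move=> /(bl_leZ imu0); rewrite scalerDr scalerA mulVf ?gt_eqF// scale1r.
have := bl_ler_norm w0 wT; rewrite normrZ ger0_norm// => h.
have : mu * `|w| <= M * `|w|.
  rewrite -ler_pdivlMl//; apply: le_trans h _.
  by rewrite ler_wpM2l.
apply: contraTeq => wn0; rewrite -ltNge ltr_pM2r// normr_gt0//.
Qed.

(* With [u = (mu - T)^-1 ((mu - lam) y^-) >= 0], the vector [y + u] is mapped by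
   [mu - T] into the cone; hence [y^- <= u], which is too small for [y^- <> 0]. *)
Lemma inverse_positive_down lam mu (K : R) : inverse_positive mu ->
  (forall x, exists u, mu *: u - T u = x) ->
  (forall u, `|u| <= K * `|mu *: u - T u|) ->
  lam <= mu -> K * (mu - lam) < 1 -> inverse_positive lam.
Proof.
move=> pos_mu surj_mu hK lemu Ksmall y hy; apply: bl_neg_eq0; set w := bl_neg y.
have w0 : le 0 w by apply: bl_neg_ge0.
have lemu' : 0 <= mu - lam by rewrite subr_ge0.
have [u hu] := surj_mu ((mu - lam) *: w).
have u0 : le 0 u by apply: pos_mu; rewrite hu; apply: bl_leZ.
have wu : le w u.
  apply: bl_neg_le => //; apply: pos_mu.
  have -> : mu *: (y + u) - T (y + u)
      = (lam *: y - T y) + (mu - lam) *: (y + w).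
    rewrite (linearD T) scalerDr opprD addrACA hu [in RHS]scalerDr [RHS]addrA.
    by congr (_ + _); rewrite scalerBl [RHS]addrC addrA subrK.
  by apply: bl_addr_ge0 => //; apply: bl_leZ => //; apply: bl_addr_neg_ge0.
have := le_trans (bl_ler_norm w0 wu) (hK u).
rewrite hu normrZ ger0_norm// mulrA.
apply: contraTeq => wn0; rewrite -ltNge -[ltRHS]mul1r ltr_pM2r// normr_gt0//.
Qed.

(** Replacing [lam] by [mu] costs at most |lam - mu| ||u||; after multiplication by [K] this is at
    most half of ||u|| and is absorbed on the left. *)
Lemma below_norm_perturb lam mu (K : R) u : 0 <= K ->
  `|u| <= K * `|lam *: u - T u| -> K * `|lam - mu| <= 2^-1 ->
  `|u| <= 2 * K * `|mu *: u - T u|.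
Proof.
move=> K0 hu hK.
have -> : 2 * K * `|mu *: u - T u| = 2 * (K * `|mu *: u - T u|) by rewrite mulrA.
have h1 : `|lam *: u - T u| <= `|mu *: u - T u| + `|lam - mu| * `|u|.
  rewrite -normrZ; apply: le_trans (ler_normD _ _).
  by rewrite scalerBl [X in _ <= `|X|]addrC addrA subrK.
have h2 := ler_wpM2l K0 h1; have h3 := ler_wpM2r (normr_ge0 u) hK.
move: h2 h3; rewrite mulrDr mulrA => h2 h3; have := normr_ge0 u; nra.
Qed.

(** Downward continuation from large parameters. The constants [K] may blow up near 1, but the
    infimum of the parameters reached is at least [mu0 > 1] and has a constant of its own, so a step
    of definite length leads past it unless [mu0] is reached. *)
Lemma inverse_positive_gt1 M : (forall x, `|T x| <= M * `|x|) ->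
  (forall mu, 1 < mu -> forall x, exists u, mu *: u - T u = x) ->
  (forall mu, 1 < mu ->
    exists K : R, forall u, `|u| <= K * `|mu *: u - T u|) ->
  forall mu, 1 < mu -> inverse_positive mu.
Proof.
move=> hM surj bdd mu0 mu0_gt1.
pose A := [set lam | mu0 <= lam /\ forall nu, lam <= nu -> inverse_positive nu].
have Aub : has_inf A.
  split; last by exists mu0 => ? [].
  exists (mu0 + `|M|); split; first by rewrite lerDl.
  move=> nu hnu; have nM : mu0 + `|M| <= nu by [].
  have := ler_norm M; have := normr_ge0 M => ? ?.
  by apply: (@inverse_positive_large M) => //; lra.
have le_inf : mu0 <= inf A by apply: lb_le_inf; [case: Aub | move=> ? []].
have inf_gt1 : 1 < inf A by apply: lt_le_trans le_inf.
have [K0 hK0] := bdd _ inf_gt1.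
pose K := `|K0| + 1.
have K_gt0 : 0 < K by rewrite ltr_wpDl.
have hK u : `|u| <= K * `|inf A *: u - T u|.
  apply: le_trans (hK0 u) _; rewrite ler_wpM2r//.
  by apply: le_trans (ler_norm _) _; rewrite lerDl.
(* With this [e], K |inf A - mu| <= 1/8 for the [mu] chosen within [e] of [inf A], so the bound
   holds at [mu] with 2K. Going down from [mu] to [inf A - e] is a distance below 2e, and 2K * 2e =
   1/2 < 1. *)
pose e := (8 * K)^-1.
have e_gt0 : 0 < e by rewrite invr_gt0 mulr_gt0.
have Ke : K * e = 8^-1 by rewrite /e; field; rewrite gt_eqF.
have [mu [mu0_le hmu] mu_lt] := inf_adherent e_gt0 Aub.
have inf_le_mu : inf A <= mu by apply: ge_inf => //; case: Aub.
(* Membership gives [inf A] <= max (mu0, inf A - e), hence [inf A] <= [mu0]; the maximum is then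
   [mu0] itself. *)
suff [_] : A (Num.max mu0 (inf A - e)).
  move=> hmax; have : inf A <= Num.max mu0 (inf A - e).
    by apply: ge_inf; [case: Aub | split => //; rewrite le_max lexx].
  by rewrite le_max => /orP[h|]; [apply: hmax; rewrite ge_max lexx/=; lra | lra].
split=> [|nu]; first by rewrite le_max lexx.
rewrite ge_max => /andP[mu0_nu nu_gt].
have [|nu_mu] := leP mu nu; first exact: hmu.
apply: (@inverse_positive_down nu mu (2 * K)).
- exact: hmu.
- by apply: surj; apply: lt_le_trans mu0_le.
- move=> u; apply: (@below_norm_perturb (inf A)); [exact: ltW| exact: hK|].
  rewrite distrC ger0_norm ?subr_ge0//.
  by have := ler_wpM2l (ltW K_gt0) (ltW mu_lt); rewrite mulrDr mulrBr; lra.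
- exact: ltW.
- rewrite -mulrA; have : K * (mu - nu) <= K * (e + e).
    by rewrite ler_wpM2l// ?(ltW K_gt0)//; lra.
  by rewrite mulrDr; lra.
Qed.

(** Put x = r v - T v, so that v plays the role of R(r,T) x. For j < n the weight r^n r^(-j-1) is at
    least 1, and the sum of r^(-j-1) T^j x telescopes to v - r^(-n) T^n v <= v. *)
Lemma partial_sum_norm_le r v n : 1 < r -> inverse_positive r ->
  le 0 (r *: v - T v) ->
  `|\sum_(j < n) iter j T (r *: v - T v)| <= r ^+ n * `|v|.
Proof.
move=> r_gt1 r_pos x0; have r_gt0 : 0 < r by apply: lt_trans r_gt1.
have v0 : le 0 v by apply: r_pos.
have rn0 : 0 <= r ^+ n by rewrite exprn_ge0// ltW.
rewrite -[X in X * `|v|]ger0_norm// -normrZ; apply: bl_ler_norm.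
  by apply: bl_sumr_ge0 => i; apply: iter_ge0.
apply: (@bl_le_trans _ _ _
  (r ^+ n *: \sum_(j < n) (r ^+ j.+1)^-1 *: iter j T (r *: v - T v))); last first.
  apply: bl_ler_wpZ2l => //; rewrite neumann_telescope ?gt_eqF//.
  apply/bl_subr_ge0; rewrite opprB addrC subrK; apply: bl_leZ.
    by rewrite invr_ge0 exprn_ge0// ltW.
  exact: iter_ge0.
rewrite scaler_sumr; apply: bl_ler_sum => i.
rewrite scalerA -[X in le X _]scale1r; apply: bl_ler_wpZ2r; last exact: iter_ge0.
by rewrite ler_pdivlMr ?exprn_gt0// mul1r ler_weXn2l// ltW.
Qed.

End PositiveOperatorTheory.

(** * Summation by parts and scalar estimates *)

Section Weights.
Context (R : realType).

Lemma abel_summation (V : lmodType R) (a : nat -> V) (c : nat -> R) n :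
  \sum_(j < n.+1) c j *: a j =
    \sum_(j < n) (c j - c j.+1) *: (\sum_(i < j.+1) a i)
      + c n *: (\sum_(i < n.+1) a i).
Proof.
elim: n => [|n IH]; first by rewrite big_ord0 add0r !big_ord1.
rewrite big_ord_recr/= IH [X in _ = X + _]big_ord_recr/= -[RHS]addrA -[LHS]addrA.
congr (_ + _).
by rewrite [X in _ = _ + _ *: X]big_ord_recr/= scalerDr addrA -scalerDl subrK.
Qed.

(** The summand is t^(-j-2) (1 - t^-2), and the geometric sum divides by 1 - t^-1. The quotient 1 +
    t^-1 stays bounded as t tends to 1. *)
Lemma abel_weights_sum (t : R) n : t != 0 ->
  \sum_(j < n) ((t ^+ 2) ^- j.+1 - (t ^+ 2) ^- j.+2) * t ^+ j
    = (1 + t^-1) * t ^- 2 * (1 - t ^- n).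
Proof.
move=> t0; elim: n => [|n IH].
  by rewrite big_ord0 expr0 invr1 subrr mulr0.
rewrite big_ord_recr /= IH.
have -> : (t ^+ 2) ^- n.+1 = t ^- 2 * t ^- n * t ^- n.
  by rewrite -exprM mulnS mul2n -addnn !exprD !invfM mulrA.
have -> : (t ^+ 2) ^- n.+2 = t ^- 4 * t ^- n * t ^- n.
  by rewrite -exprM !mulnS mul2n -addnn addnA !exprD -exprD !invfM mulrA.
by rewrite !exprS expr0; field; rewrite t0 expf_neq0.
Qed.

(** Writing the ratio as t^2 lets one factor t^-j absorb the growth of the partial sums and the
    other make the Abel sum converge, with a bound free of [t]. *)
Lemma weighted_sum_norm_le (V : normedModType R) (a : nat -> V) (D t : R) n :
  1 < t -> (forall j, `|\sum_(i < j.+1) a i| <= D * t ^+ j) ->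
  `|\sum_(j < n.+1) (t ^+ 2) ^- j.+1 *: a j| <= 2 * D.
Proof.
move=> t1 ha; have t0 : 0 < t by apply: lt_trans t1.
have D0 : 0 <= D by have := le_trans (normr_ge0 _) (ha 0%N); rewrite expr0 mulr1.
pose c j := (t ^+ 2) ^- j.
have c0 j : 0 <= c j by rewrite invr_ge0 !exprn_ge0// ltW.
have cd j : 0 <= c j.+1 - c j.+2.
  rewrite subr_ge0 lef_pV2 ?posrE ?exprn_gt0// ler_weXn2l//.
  by rewrite exprn_ege1// ltW.
rewrite (abel_summation a (fun j => c j.+1)) -/(c _); apply: le_trans (ler_normD _ _) _.
have h1 : `|\sum_(j < n) (c j.+1 - c j.+2) *: \sum_(i < j.+1) a i|
    <= D * \sum_(j < n) (c j.+1 - c j.+2) * t ^+ j.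
  apply: le_trans (ler_norm_sum _ _ _) _; rewrite mulr_sumr; apply: ler_sum => j _.
  rewrite normrZ ger0_norm// [leRHS]mulrCA; exact: ler_wpM2l.
have h2 : `|c n.+1 *: \sum_(i < n.+1) a i| <= D * (c n.+1 * t ^+ n).
  by rewrite normrZ ger0_norm// [leRHS]mulrCA; exact: ler_wpM2l.
apply: le_trans (lerD h1 h2) _; rewrite -mulrDr [leRHS]mulrC ler_wpM2l//.
rewrite abel_weights_sum ?gt_eqF//.
have -> : c n.+1 * t ^+ n = t ^- 2 * t ^- n.
  rewrite /c -exprM mulnS mul2n -addnn !exprD !invfM -!mulrA mulVf ?mulr1//.
  by rewrite expf_neq0// gt_eqF.
have q0 : 0 < t^-1 by rewrite invr_gt0.
have q1 : t^-1 < 1 by rewrite invf_lt1.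
have w0 : 0 < t ^- n by rewrite invr_gt0 exprn_gt0.
have w1 : t ^- n <= 1 by rewrite invf_le1 ?exprn_gt0// exprn_ege1// ltW.
(* With q = 1/t and w = t^-n the claim is (1 + q) q^2 (1 - w) + q^2 w <= 2, since the left side is
   at most 2 (1 - w) + w. *)
rewrite -[t ^- 2]exprVn; move: (t^-1) (t ^- n) q0 q1 w0 w1 => q w q0 q1 w0 w1.
have q2 : q ^+ 2 <= 1 by rewrite exprn_ile1// ltW.
have g1 : (1 + q) * q ^+ 2 <= (1 + 1) * 1.
  by apply: ler_pM; rewrite ?sqr_ge0//; lra.
have g2 : q ^+ 2 * w <= 1 * w by rewrite ler_wpM2r// ltW.
have g3 : (1 + q) * q ^+ 2 * (1 - w) <= (1 + 1) * 1 * (1 - w).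
  by rewrite ler_wpM2r// subr_ge0.
lra.
Qed.

(** The inequality x <= exp x at x = n ln t / b, raised to the power [b], together with a linear
    lower bound of ln t in [s]. *)
Lemma powR_nat_le_exp (b s t : R) n : 1 <= b -> 0 < s < 1 -> 1 <= t ->
  t ^+ 2 = 1 + s -> n%:R `^ b <= (6 * b) `^ b / s `^ b * t ^+ n.
Proof.
move=> b1 /andP[s0 s1] t1 tE.
have b0 : 0 < b by apply: lt_le_trans b1.
have t0 : 0 < t by apply: lt_le_trans t1.
(* Here ln t >= (t - 1)/t and t - 1 = s/(t + 1); the 6 bounds t (t + 1), because t <= 2. *)
have lnt : s / 6 <= ln t.
  have h : t^-1 * (t - 1) <= ln t.
    rewrite mulrBr mulVf ?gt_eqF// mulr1.
    have := @le_ln1Dx R (t^-1 - 1); rewrite addrCA subrr addr0 lnV ?posrE//.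
    by rewrite ltrBrDl subrr invr_gt0 => /(_ t0); lra.
  apply: le_trans h; rewrite ler_pdivlMl//.
  have : t <= 2 by rewrite -(@ler_pXn2r _ 2) ?nnegrE ?ltW// tE; lra.
  have : (t - 1) * (t + 1) = s by rewrite -subr_sqr_1 tE; ring.
  by nra.
have key : n%:R * s / (6 * b) <= expR (n%:R * ln t / b).
  apply: le_trans (expR_ge1Dx _); rewrite ler_wpDl//.
  rewrite invfM mulrA ler_wpM2r ?invr_ge0 ?(ltW b0)// -mulrA.
  by rewrite ler_wpM2l ?ler0n//.
have key2 : (n%:R * s / (6 * b)) `^ b <= t ^+ n.
  have -> : t ^+ n = expR (n%:R * ln t / b) `^ b.
    rewrite -expRM mulrC.
    by rewrite [b * _]mulrC divfK ?gt_eqF// mulrC expRM_natr lnK ?posrE.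
  apply: ge0_ler_powR => //; rewrite ?nnegrE ?expR_ge0 ?(ltW b0)//.
  by rewrite !mulr_ge0 ?invr_ge0 ?mulr_ge0 ?(ltW b0) ?(ltW s0).
have -> : n%:R = n%:R * s / (6 * b) * (6 * b / s).
  by field; rewrite gt_eqF//= gt_eqF.
rewrite [leLHS]powRM ?divr_ge0 ?mulr_ge0 ?(ltW b0) ?(ltW s0)//.
rewrite [leRHS]mulrC; apply: ler_pM => //; rewrite ?powR_ge0//.
rewrite powRM ?invr_ge0 ?mulr_ge0 ?(ltW b0) ?(ltW s0)//.
by rewrite -powR_inv1 ?(ltW s0)// -powRrM mulN1r powRN.
Qed.

End Weights.

(** * Real-valued norms and the operator norm *)

Section RealValuedNorm.
Local Open Scope complex_scope.
Context (R : realType) (X : normedModType R[i]).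
Implicit Types (x y : X) (c : R[i]) (a M : R).

Lemma rnormE (V : normedZmodType R[i]) (v : V) : `|v| = (rnorm v)%:C.
Proof.
by rewrite /rnorm; have := normr_ge0 v; case: `|v| => a b; rewrite lecE/= => /andP[/eqP ->].
Qed.

Lemma rnorm_ge0 (V : normedZmodType R[i]) (v : V) : 0 <= rnorm v.
Proof. by rewrite -ler0c -rnormE. Qed.

Lemma rnorm_gt0 x : (0 < rnorm x) = (x != 0).
Proof. by rewrite -ltcR -rnormE normr_gt0. Qed.

Lemma rnormD x y : rnorm (x + y) <= rnorm x + rnorm y.
Proof. by rewrite -lecR -rnormE raddfD/= -!rnormE ler_normD. Qed.

Lemma rnormN x : rnorm (- x) = rnorm x.
Proof. by rewrite /rnorm normrN. Qed.

Lemma rnormZ c x : rnorm (c *: x) = rnorm c * rnorm x.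
Proof. by apply: complexI; rewrite -rnormE normrZ !rnormE -rmorphM. Qed.

Lemma rnorm0 : rnorm (0 : X) = 0.
Proof. by rewrite /rnorm normr0. Qed.

Lemma rnorm_sqr c : rnorm c ^+ 2 = complex.Re c ^+ 2 + complex.Im c ^+ 2.
Proof. by apply: complexI; rewrite add_Re2_Im2 rmorphXn/= -rnormE. Qed.

Lemma rnormX c n : rnorm (c ^+ n) = rnorm c ^+ n.
Proof. by apply: complexI; rewrite rmorphXn/= -!rnormE normrX. Qed.

Lemma rnormV c : rnorm c^-1 = (rnorm c)^-1.
Proof. by apply: complexI; rewrite fmorphV/= -!rnormE normfV. Qed.

Lemma rnorm_real a : rnorm a%:C = `|a|.
Proof. by apply: complexI; rewrite -rnormE normc_def/= expr0n addr0 sqrtr_sqr. Qed.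

Lemma ler_rnorm_sum (I : Type) (r : seq I) (F : I -> X) :
  rnorm (\sum_(i <- r) F i) <= \sum_(i <- r) rnorm (F i).
Proof.
elim/big_ind2: _ => [|x1 x2 y1 y2 h1 h2|//]; first by rewrite rnorm0.
exact: le_trans (rnormD _ _) (lerD h1 h2).
Qed.

Lemma linear_bounded (f : {linear X -> X}) : continuous f ->
  exists2 M, 0 <= M & forall x, rnorm (f x) <= M * rnorm x.
Proof.
move=> /linear_bounded_continuous /linear_boundedP [M [Mreal hM]].
have [M0 M0E] : exists a, M = a%:C by case/complex_realP: Mreal => a ->; exists a.
(* The bound holds for every constant strictly above [M0]; this one is also nonnegative. *)
exists (`|M0| + 1); first by rewrite addr_ge0.
move=> x; rewrite -lecR rmorphM/= -!rnormE; apply: hM.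
by rewrite M0E ltcR (le_lt_trans (ler_norm _))// ltrDl.
Qed.

Lemma rnorm_bounded_continuous (f : {linear X -> X}) M :
  (forall x, rnorm (f x) <= M * rnorm x) -> continuous f.
Proof.
move=> hM; apply: bounded_linear_continuous; apply/linear_boundedP.
near=> r => x; rewrite !rnormE.
have r_ge : M%:C <= r by near: r; apply: nbhs_pinfty_ge; apply/complex_realP; exists M.
apply: (@le_trans _ _ (M * rnorm x)%:C); first by rewrite lecR.
by rewrite rmorphM/= ler_wpM2r// -[0]/(0%:C) lecR rnorm_ge0.
Unshelve. all: by end_near. Qed.

Lemma cvg_rnormP (u : nat -> X) (l : X) :
  u @ \oo --> l <-> forall e : R, 0 < e ->
    exists N, forall n, (N <= n)%N -> rnorm (l - u n) < e.
Proof.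
split=> [/cvgrPdist_lt h e e0|h].
  have [|N _ hN] := h e%:C; first by rewrite -[0]/(0%:C) ltcR.
  by exists N => n Nn; rewrite -ltcR -rnormE; apply: hN.
apply/cvgrPdist_lt => e e0.
have eE : e = (complex.Re e)%:C by move: e0; rewrite ltcE; case: e => a b /= /andP[/eqP ->].
have [|N hN] := h (complex.Re e); first by move: e0; rewrite eE ltcR.
exists N => // n /= Nn. rewrite eE rnormE ltcR. by apply: hN.
Qed.

Lemma opnorm_le (A : X -> X) M : 0 <= M ->
  (forall x, rnorm (A x) <= M * rnorm x) -> opnorm A <= M.
Proof.
move=> M0 hM; apply: ge_sup; first by exists (rnorm (A 0)), 0 => //=; rewrite rnorm0.
move=> _ [x /= x1 <-]; apply: le_trans (hM x) _.
by rewrite -[leRHS]mulr1 ler_wpM2l.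
Qed.

(** Normalise [x]. The bound [M] makes the set under [sup] bounded, so that [opnorm A] is a true
    supremum and not the default value 0. *)
Lemma rnorm_le_opnorm (A : X -> X) M x :
  (forall c x, A (c *: x) = c *: A x) ->
  (forall x, rnorm (A x) <= M * rnorm x) -> rnorm (A x) <= opnorm A * rnorm x.
Proof.
move=> AZ hM; have [->|x0] := eqVneq x 0.
  by have := AZ 0 0; rewrite !scale0r => ->; rewrite rnorm0 mulr0.
have nx0 : 0 < rnorm x by rewrite rnorm_gt0.
have xE : x = (rnorm x)%:C *: ((rnorm x)^-1%:C *: x).
  by rewrite scalerA -rmorphM/= mulfV ?gt_eqF// scale1r.
rewrite {1}xE AZ rnormZ rnorm_real (ger0_norm (ltW nx0)) mulrC ler_wpM2r ?(ltW nx0)//.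
apply: ub_le_sup; last first.
  exists ((rnorm x)^-1%:C *: x) => //=.
  by rewrite rnormZ rnorm_real ger0_norm ?invr_ge0 ?(ltW nx0)// mulVf ?gt_eqF.
exists `|M| => _ [y /= y1 <-]; apply: le_trans (hM y) _.
apply: le_trans (ler_norm _) _; rewrite normrM (ger0_norm (rnorm_ge0 _)).
by rewrite -[leRHS]mulr1 ler_wpM2l.
Qed.

End RealValuedNorm.

(** * Positive operators on a complex Banach lattice *)

Section ComplexBanachLatticeTheory.
Local Open Scope complex_scope.
Context (R : realType) (X : complexBanachLattice R).
Local Notation E := (cbl_real X).
Local Notation embed := (@cbl_embed R X).
Local Notation le := (@bl_le R E).
Implicit Types (x y : E) (z : X).

Lemma embed0 : embed 0 = 0.
Proof.
have := cbl_embedD (0 : E) 0; rewrite addr0 => /esym/eqP.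
by rewrite -subr_eq0 addrK => /eqP.
Qed.

Lemma embedN x : embed (- x) = - embed x.
Proof. by apply/eqP; rewrite -addr_eq0 -cbl_embedD addNr embed0. Qed.

Lemma embedB x y : embed (x - y) = embed x - embed y.
Proof. by rewrite cbl_embedD embedN. Qed.

Lemma embed_sum n (F : 'I_n -> E) : embed (\sum_(i < n) F i) = \sum_(i < n) embed (F i).
Proof. by elim/big_rec2: _ => [|i a b _ <-]; rewrite ?embed0// cbl_embedD. Qed.

Lemma decomp_inj x y x' y' :
  embed x + 'i *: embed y = embed x' + 'i *: embed y' -> x = x' /\ y = y'.
Proof.
by move=> h; have /bij_inj := cbl_decomp X => /(_ (x, y) (x', y') h) [].
Qed.

Lemma decomp_ex z : exists x y, z = embed x + 'i *: embed y.
Proof. by have [g _ gK] := cbl_decomp X; exists (g z).1, (g z).2; rewrite gK. Qed.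

Lemma embed_inj : injective embed.
Proof.
move=> x y h; have [] // := @decomp_inj x 0 y 0.
by rewrite h.
Qed.

Lemma rnorm_embed x : rnorm (embed x) = `|x|.
Proof.
have [m hm] := cbl_normE x 0.
rewrite embed0 scaler0 addr0 rnormE => /complexI ->.
exact: is_modulus_real_norm hm.
Qed.

Section RealPart.
Variable T : {linear X -> X}.
Hypothesis T_pos : positive_op T.

(** Each real x is the difference of the positive vectors x + x^- and x^-, so T x is real; linearity
    passes through the injective embedding. *)
Lemma positive_op_real : exists2 TE : {linear E -> E},
  (forall x, le 0 x -> le 0 (TE x)) & forall x, T (embed x) = embed (TE x).
Proof.
have h x : exists y, T (embed x) = embed y.
  have [a _ ha] := T_pos (bl_addr_neg_ge0 x).
  have [b _ hb] := T_pos (bl_neg_ge0 x).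
  exists (a - b); rewrite embedB -ha -hb -linearB; congr (T _).
  by rewrite cbl_embedD addrK.
have [f hf] := choice h.
have f_lin : linear f.
  move=> a x y; apply: embed_inj.
  by rewrite -hf !(cbl_embedD, cbl_embedZ) linearP !hf.
pose TE : {linear E -> E} := HB.pack f (GRing.isLinear.Build _ _ _ _ f f_lin).
exists TE => // x x0; have [y y0] := T_pos x0.
by rewrite hf => /embed_inj fx; rewrite -[TE x]/(f x) fx.
Qed.

Variable TE : {linear E -> E}.
Hypothesis TE_ge0 : forall x, le 0 x -> le 0 (TE x).
Hypothesis TEP : forall x, T (embed x) = embed (TE x).

Lemma iter_embed n x : iter n T (embed x) = embed (iter n TE x).
Proof. by elim: n => //= n ->. Qed.

Lemma iter_decomp n x y :
  iter n T (embed x + 'i *: embed y) = embed (iter n TE x) + 'i *: embed (iter n TE y).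
Proof. by elim: n => //= n ->; rewrite linearD linearZ !TEP. Qed.

(** Here m = |z|, and the last clause is the norm form of |sum c_j T^j z| <= sum |c_j| T^j |z|. One
    [m] serves all coefficients. *)
Lemma modulus_ex z : exists m : E, [/\ le 0 m, `|m| = rnorm z &
  forall (c : nat -> R[i]) n, rnorm (\sum_(j < n) c j *: iter j T z)
    <= `|\sum_(j < n) rnorm (c j) *: iter j TE m|].
Proof.
have [x [y zE]] := decomp_ex z; have [m hm mE] := cbl_normE x y.
exists m; have m0 := is_modulus_ge0 hm; split => //.
  by apply: complexI; rewrite -rnormE zE mE.
move=> c n; pose re j := complex.Re (c j); pose im j := complex.Im (c j).
pose X' := \sum_(j < n) (re j *: iter j TE x - im j *: iter j TE y).
pose Y' := \sum_(j < n) (im j *: iter j TE x + re j *: iter j TE y).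
have -> : \sum_(j < n) c j *: iter j T z = embed X' + 'i *: embed Y'.
  rewrite !embed_sum scaler_sumr -big_split/=; apply: eq_bigr => j _.
  rewrite zE iter_decomp embedB !cbl_embedD !cbl_embedZ.
  rewrite -scaleNr !scalerDr !scalerA addrACA -!scalerDl.
  have cE : c j = (re j)%:C + 'i * (im j)%:C by rewrite {1}[c j]complexE.
  have ciE : c j * 'i = - (im j)%:C + 'i * (re j)%:C.
    by rewrite cE mulrDl mulrAC -expr2 sqr_i mulN1r addrC mulrC.
  by rewrite ciE -cE.
have [m' hm' m'E] := cbl_normE X' Y'.
have m'0 := is_modulus_ge0 hm'.
have -> : rnorm (embed X' + 'i *: embed Y') = `|m'|.
  by apply: complexI; rewrite -rnormE m'E.
apply: bl_ler_norm => //; case: hm' => _; apply=> _ [t _ <-].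
(* The rotated real part is a sum of T^j (a_j x + b_j y) with a_j^2 + b_j^2 = |c_j|^2. Hence a_j x +
   b_j y <= |c_j| m, and positivity of T^j keeps this order. *)
have -> : cos t *: X' + sin t *: Y' = \sum_(j < n)
   ((cos t * re j + sin t * im j) *: iter j TE x
    + (sin t * re j - cos t * im j) *: iter j TE y).
  rewrite !scaler_sumr -big_split/=; apply: eq_bigr => j _.
  rewrite !scalerDr scalerN !scalerA addrACA -scalerDl; congr (_ + _).
  by rewrite -scaleNr -scalerDl addrC.
apply: bl_ler_sum => j.
rewrite -!linear_iterZ -linear_iterD; apply/bl_subr_ge0; rewrite -linear_iterB.
apply: (iter_ge0 TE_ge0); apply/bl_subr_ge0.
apply: (is_modulus_comb_le hm); first exact: rnorm_ge0.
rewrite rnorm_sqr -/(re j) -/(im j).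
have := cos2Dsin2 t; move: (cos t) (sin t) => C S CS.
by rewrite -[RHS]mul1r -CS; ring.
Qed.

End RealPart.

End ComplexBanachLatticeTheory.

(** * Polynomials in the operator *)

Section PowerSums.
Local Open Scope complex_scope.
Context (R : realType) (X : normedModType R[i]) (T : {linear X -> X}).
Implicit Types (c : nat -> R[i]) (x : X) (l : R[i]).

(** Common form of the sums S_n^1(T), with c = 1, and of the truncated Neumann series, with c_j =
    l^(-j-1). *)
Definition power_sum c n x : X := \sum_(j < n) c j *: iter j T x.

Lemma power_sum_linear c n a x y :
  power_sum c n (a *: x + y) = a *: power_sum c n x + power_sum c n y.
Proof.
rewrite /power_sum scaler_sumr -big_split; apply: eq_bigr => j _ /=.
by rewrite linear_iterP scalerDr !scalerA mulrC.
Qed.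

Lemma power_sumZ c n a x : power_sum c n (a *: x) = a *: power_sum c n x.
Proof.
have := power_sum_linear c n 1 0 0; rewrite !scale1r addr0 => /eqP.
rewrite -subr_eq0 opprD addrA subrr sub0r oppr_eq0 => /eqP p0.
by have := power_sum_linear c n a x 0; rewrite p0 !addr0.
Qed.

Lemma sum_iterE n :
  (fun x => \sum_(0 <= j < n.+1) iter j T x) = power_sum (fun=> 1) n.+1.
Proof.
by apply/funext => x; rewrite big_mkord; apply: eq_bigr => j _; rewrite scale1r.
Qed.

Lemma neumann_sumE l n :
  (fun x => \sum_(0 <= j < n.+1) (l ^+ j.+1)^-1 *: iter j T x)
    = power_sum (fun j => (l ^+ j.+1)^-1) n.+1.
Proof. by apply/funext => x; rewrite big_mkord. Qed.

(** In the limit this turns a left inverse of l - T into a right inverse. *)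
Lemma power_sum_commute l c n x :
  power_sum c n (l *: x - T x) = l *: power_sum c n x - T (power_sum c n x).
Proof.
rewrite -[- T x]scaleN1r addrC power_sum_linear power_sumZ scaleN1r addrC.
congr (_ - _); rewrite /power_sum raddf_sum; apply: eq_bigr => j _ /=.
by rewrite linearZ -iterS iterSr.
Qed.

Hypothesis T_cont : continuous T.

Lemma rnorm_power_sum_le c n x :
  rnorm (power_sum c n x) <= opnorm (power_sum c n) * rnorm x.
Proof.
have [M M0 hM] := linear_bounded T_cont.
apply: (@rnorm_le_opnorm _ _ _ (\sum_(j < n) rnorm (c j) * M ^+ j)).
  by move=> a y; apply: power_sumZ.
move=> y; apply: le_trans (ler_rnorm_sum _ _) _.
rewrite mulr_suml; apply: ler_sum => j _.
rewrite rnormZ -mulrA ler_wpM2l ?rnorm_ge0//.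
elim: (nat_of_ord j) => [|k IH]; first by rewrite expr0 mul1r.
rewrite iterS exprS -mulrA; apply: le_trans (hM _) _; exact: ler_wpM2l.
Qed.

End PowerSums.

(** * Limits and geometric series *)

Section Convergence.
Local Open Scope complex_scope.
Context (R : realType).

(** The range [1 < n] matches [uniformly_Kreiss_bounded], which controls only sums of at least two
    terms. *)
Lemma rnorm_lim_le (V : normedModType R[i]) (u : nat -> V) (v : V) (K : R) :
  u @ \oo --> v -> (forall n, (1 < n)%N -> rnorm (u n) <= K) -> rnorm v <= K.
Proof.
move=> /cvg_rnormP uv hK; apply/ler_addgt0Pr => e e0.
have [N hN] := uv e e0.
have h1 := hN (maxn N 2) (leq_maxl _ _).
have h2 := hK (maxn N 2) (leq_maxr _ _).
rewrite -[v](subrK (u (maxn N 2))); apply: le_trans (rnormD _ _) _.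
by rewrite addrC lerD// ltW.
Qed.

Lemma geometric_cvg (q : R) : 0 <= q < 1 -> forall B e : R, 0 < e ->
  exists N, forall n, (N <= n)%N -> B * q ^+ n < e.
Proof.
move=> /andP[q0 q1] B e e0.
have : (fun n => B * q ^+ n) @ \oo --> (B * 0 : R).
  by apply: cvgMr; apply: cvg_expr; rewrite ger0_norm.
rewrite mulr0 => /cvgrPdist_lt /(_ e e0) [N _ hN].
exists N => n /hN /=; rewrite sub0r normrN; apply: le_lt_trans; exact: ler_norm.
Qed.

Lemma geometric_sum_le (q : R) n m : 0 <= q < 1 ->
  \sum_(n <= k < m) q ^+ k <= q ^+ n / (1 - q).
Proof.
move=> /andP[q0 q1]; rewrite ler_pdivlMr ?subr_gt0// mulrC.
have [nm|mn] := leqP n m; last first.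
  by rewrite big_geq ?(ltnW mn)// mulr0 exprn_ge0.
have -> : (1 - q) * \sum_(n <= k < m) q ^+ k = - \sum_(n <= k < m) (q ^+ k.+1 - q ^+ k).
  rewrite mulr_sumr -sumrN; apply: eq_bigr => k _.
  by rewrite opprB mulrBl mul1r exprS.
by rewrite telescope_sumr// opprB gerBl exprn_ge0.
Qed.

Lemma geometric_series_cvg (V : completeNormedModType R[i]) (v : nat -> V)
    (B q : R) : 0 <= q < 1 -> (forall k, rnorm (v k) <= B * q ^+ k) ->
  exists s : V, (fun n => \sum_(k < n) v k) @ \oo --> s.
Proof.
move=> q01 hv; have /andP[q0 q1] := q01.
have B0 : 0 <= B by have := le_trans (rnorm_ge0 _) (hv 0%N); rewrite expr0 mulr1.
have seriesE : series v = (fun n => \sum_(k < n) v k).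
  by apply/funext => n; rewrite /series/= big_mkord.
suff : cvgn (series v).
  by rewrite seriesE => h; exists (lim ((fun n => \sum_(k < n) v k) @ \oo)).
apply/cauchy_cvgP/cauchy_seriesP => e e0.
have eE : e = (complex.Re e)%:C by move: e0; rewrite ltcE; case: e => a b /= /andP[/eqP ->].
have e'0 : 0 < complex.Re e by move: e0; rewrite eE ltcR.
have [N hN] := geometric_cvg q01 (B / (1 - q)) e'0.
exists ([set n | (N <= n)%N], [set n | (N <= n)%N]).
  by split; exists N.
move=> [n m] /= [Nn _]; rewrite rnormE eE ltcR.
apply: le_lt_trans (hN n Nn); apply: le_trans (ler_rnorm_sum _ _) _.
apply: (@le_trans _ _ (\sum_(n <= k < m) B * q ^+ k)); first by apply: ler_sum.
by rewrite -mulr_sumr mulrAC -mulrA ler_wpM2l// geometric_sum_le.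
Qed.

End Convergence.

(** * From (1) to (2) *)

Section CesaroToUniformKreiss.
Local Open Scope complex_scope.
Context (R : realType) (X : complexBanachLattice R) (T : {linear X -> X}).
Local Notation embed := (@cbl_embed R X).
Hypotheses (T_cont : continuous T) (T_pos : positive_op T).

Lemma C1_uniformly_Kreiss (beta : R) : 1 <= beta ->
  C1_bounded beta T -> uniformly_Kreiss_bounded beta T.
Proof.
move=> beta_ge1 [C C0 hC]; have [TE TE_ge0 TEP] := positive_op_real T_pos.
have b0 : 0 < beta by apply: lt_le_trans beta_ge1.
(* [C] serves the partial sums with at least two terms. The added 1 covers the one-term sum, which
   the hypothesis omits; there K / s^beta >= 1 suffices. *)
pose K := (C + 1) * (6 * beta) `^ beta.
have sixb : 1 <= (6 * beta) `^ beta.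
  by rewrite -{1}(powRr0 (6 * beta)); apply: ler_powR; [lra | exact: ltW].
have K0 : 0 < K by rewrite mulr_gt0 ?ltr_wpDl// ?(ltW C0)// (lt_le_trans _ sixb).
exists (2 * K) => [|l n /andP[l1 l2] n0]; first by rewrite mulr_gt0.
rewrite neumann_sumE; set r := rnorm l in l1 l2 *; pose s := r - 1.
have s0 : 0 < s by rewrite subr_gt0.
have s1 : s < 1 by rewrite /s; lra.
have sb0 : 0 < s `^ beta by rewrite powR_gt0.
have sb1 : s `^ beta <= 1.
  by rewrite -(powRr0 s); apply: ger_powR; rewrite ?s0 ltW.
apply: opnorm_le => [|z]; first by rewrite divr_ge0 ?powR_ge0// mulr_ge0// ltW.
have [m [m0 mE hm]] := modulus_ex TE_ge0 TEP z.
apply: le_trans (hm _ _) _.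
have r0 : 0 <= r by rewrite ltW// (lt_trans _ l1).
pose t := Num.sqrt r; have tE : t ^+ 2 = r by rewrite sqr_sqrtr.
have t1 : 1 < t by rewrite -sqrtr1 ltr_sqrt// (lt_trans _ l1).
have -> : \sum_(j < n.+1) rnorm (l ^+ j.+1)^-1 *: iter j TE m
    = \sum_(j < n.+1) (t ^+ 2) ^- j.+1 *: iter j TE m.
  by apply: eq_bigr => j _; rewrite tE rnormV rnormX.
have -> : 2 * K / s `^ beta * rnorm z = 2 * (K / s `^ beta * rnorm z).
  by rewrite !mulrA.
apply: (@weighted_sum_norm_le _ _ (fun j => iter j TE m)) => // j.
have invsb : 1 <= (6 * beta) `^ beta / s `^ beta.
  by rewrite ler_pdivlMr// mul1r (le_trans sb1).
case: j => [|j].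
  rewrite big_ord1 expr0 mulr1 /= mE -[leLHS]mul1r ler_wpM2r ?rnorm_ge0//.
  by rewrite /K -mulrA; have := invsb; nra.
have hj : `|\sum_(i < j.+2) iter i TE m| <= C * j.+1%:R `^ beta * rnorm z.
  have -> : `|\sum_(i < j.+2) iter i TE m| = rnorm (power_sum T (fun=> 1) j.+2 (embed m)).
    rewrite -rnorm_embed embed_sum; congr rnorm; apply: eq_bigr => i _.
    by rewrite scale1r (iter_embed TEP).
  apply: le_trans (rnorm_power_sum_le T_cont _ _ _) _.
  by rewrite rnorm_embed mE ler_wpM2r ?rnorm_ge0// -sum_iterE hC.
apply: le_trans hj _; rewrite [leRHS]mulrAC ler_wpM2r ?rnorm_ge0//.
have h := @powR_nat_le_exp _ beta s t j.+1 beta_ge1.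
have {}h : j.+1%:R `^ beta <= (6 * beta) `^ beta / s `^ beta * t ^+ j.+1.
  by apply: h; rewrite ?s0 ?s1 ?(ltW t1)// tE /s addrC subrK.
apply: (@le_trans _ _ (C * ((6 * beta) `^ beta / s `^ beta * t ^+ j.+1))).
  by rewrite ler_wpM2l// ltW.
rewrite /K -!mulrA ler_wpM2r//; last by rewrite lerDl.
by rewrite !mulr_ge0 ?powR_ge0 ?invr_ge0 ?powR_ge0 ?exprn_ge0 ?sqrtr_ge0.
Qed.

End CesaroToUniformKreiss.

(** * From (2) to (3) *)

Section UniformKreissToKreiss.
Local Open Scope complex_scope.
Context (R : realType) (X : completeNormedModType R[i]) (T : {linear X -> X}) (beta : R).
Hypothesis T_cont : continuous T.

Lemma uniform_Kreiss_iter_growth (rho : R) : uniformly_Kreiss_bounded beta T ->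
  1 < rho < 2 -> exists M : R, forall n x, rnorm (iter n T x) <= M * rho ^+ n * rnorm x.
Proof.
move=> [C C0 hC] rho12; have /andP[rho1 rho2] := rho12.
have [M M0 hM] := linear_bounded T_cont.
have rho0 : 0 < rho by apply: lt_trans rho1.
have nrho : rnorm (rho%:C) = rho by rewrite rnorm_real gtr0_norm.
pose B := C / (rho - 1) `^ beta.
have B0 : 0 <= B by rewrite divr_ge0 ?powR_ge0// ltW.
have hP n x : (0 < n)%N ->
    rnorm (power_sum T (fun j => (rho%:C ^+ j.+1)^-1) n.+1 x) <= B * rnorm x.
  move=> n0; apply: le_trans (rnorm_power_sum_le T_cont _ _ _) _.
  rewrite ler_wpM2r ?rnorm_ge0// -neumann_sumE /B -{2}nrho; apply: hC => //.
  by rewrite nrho.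
have Brho : 0 <= B * rho by apply: mulr_ge0 => //; apply: ltW.
(* For exponents at least 2, rho^(-k-1) T^k is a difference of two consecutive Neumann sums, each
   bounded by [B]. Exponents 0 and 1 are separate, as the one-term sum is not controlled; they
   account for 1 and [M]. *)
exists (1 + M + 2 * B * rho) => -[|[|n]] x /=.
- rewrite expr0 mulr1 -[leLHS]mul1r ler_wpM2r ?rnorm_ge0//.
  by lra.
- rewrite expr1; apply: le_trans (hM x) _; rewrite ler_wpM2r ?rnorm_ge0//.
  by nra.
have h1 := hP n.+2 x isT; have h2 := hP n.+1 x isT.
have E : (rho%:C ^+ n.+3)^-1 *: iter n.+2 T x
   = power_sum T (fun j => (rho%:C ^+ j.+1)^-1) n.+3 x
     - power_sum T (fun j => (rho%:C ^+ j.+1)^-1) n.+2 x.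
  by rewrite /power_sum [in X in _ = X - _]big_ord_recr/= addrAC subrr add0r.
have h3 : rnorm ((rho%:C ^+ n.+3)^-1 *: iter n.+2 T x) <= 2 * B * rnorm x.
  rewrite E; apply: le_trans (rnormD _ _) _; rewrite rnormN; lra.
rewrite rnormZ rnormV rnormX nrho ler_pdivrMl ?exprn_gt0// in h3.
apply: le_trans h3 _.
rewrite exprS; have := rnorm_ge0 x; have := exprn_ge0 n.+2 (ltW rho0).
move: (rho ^+ n.+2) (rnorm x) => p y p0 y0.
have -> : rho * p * (2 * B * y) = (2 * B * rho) * p * y by ring.
rewrite ler_wpM2r// ler_wpM2r// lerDr; lra.
Qed.

(** The growth bound makes the Neumann series geometric of ratio [q]. Its pointwise sum is linear,
    is bounded by M / (1 - q), and inverts l - T by telescoping. *)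
Lemma neumann_resolvent (l : R[i]) (M q : R) : 0 <= q < 1 -> 1 < rnorm l ->
  (forall n x, rnorm (iter n T x) <= M * (q * rnorm l) ^+ n * rnorm x) ->
  exists2 S, is_resolvent T l S &
    forall x, (fun n => power_sum T (fun j => (l ^+ j.+1)^-1) n x) @ \oo --> S x.
Proof.
move=> q01 l1 hM.
have nl0 : 0 < rnorm l by apply: lt_trans l1.
have l0 : l != 0 by apply: contraTneq nl0 => ->; rewrite rnorm_real normr0 ltxx.
have hterm n x : rnorm ((l ^+ n)^-1 *: iter n T x) <= M * rnorm x * q ^+ n.
  rewrite rnormZ rnormV rnormX ler_pdivrMl ?exprn_gt0//.
  apply: le_trans (hM n x) _; rewrite exprMn le_eqVlt; apply/orP; left; apply/eqP; ring.
have hterm' n x : rnorm ((l ^+ n.+1)^-1 *: iter n T x) <= M * rnorm x * q ^+ n.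
  apply: le_trans (hterm n x); rewrite !rnormZ ler_wpM2r ?rnorm_ge0//.
  rewrite !rnormV !rnormX lef_pV2 ?posrE ?exprn_gt0// ler_eXn2l//.
have hcvg x : exists s : X,
    (fun n => power_sum T (fun j => (l ^+ j.+1)^-1) n x) @ \oo --> s.
  exact: (geometric_series_cvg q01 (fun k => hterm' k x)).
have [S hS] := choice hcvg.
have S_lin : linear S.
  move=> a x y; apply: (@cvg_unique _ (@norm_hausdorff _ X) _ _ _ _ (hS (a *: x + y))).
  rewrite /=; under eq_fun do rewrite power_sum_linear.
  by apply: cvgD; [apply: cvgZr | ]; apply: hS.
pose Sl : {linear X -> X} := HB.pack S (GRing.isLinear.Build _ _ _ _ S S_lin).
have S_cont : continuous S.
  apply: (@rnorm_bounded_continuous _ _ Sl (M / (1 - q))) => x.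
  apply: (rnorm_lim_le (hS x)) => n _.
  apply: le_trans (ler_rnorm_sum _ _) _.
  apply: (@le_trans _ _ (\sum_(k < n) M * rnorm x * q ^+ k)).
    by apply: ler_sum => k _; apply: hterm'.
  rewrite -mulr_sumr -(big_mkord xpredT (fun k => q ^+ k)).
  rewrite [leRHS]mulrAC ler_wpM2l//; last first.
    by have := @geometric_sum_le _ q 0 n q01; rewrite expr0 mul1r.
  by have := le_trans (rnorm_ge0 _) (hterm 0%N x); rewrite expr0 mulr1.
have hT x : (fun n => power_sum T (fun j => (l ^+ j.+1)^-1) n (l *: x - T x)) @ \oo --> x.
  apply/cvg_rnormP => e e0.
  have [N hN] := geometric_cvg q01 (M * rnorm x) e0.
  exists N => n Nn; rewrite /power_sum neumann_telescope// subKr.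
  exact: le_lt_trans (hterm n x) (hN n Nn).
exists S => //; split => // x.
  exact: (@cvg_unique _ (@norm_hausdorff _ X) _ _ _ _ (hS _) (hT x)).
apply: (@cvg_unique _ (@norm_hausdorff _ X) _ _ _ _ _ (hT x)).
rewrite /=; under eq_fun do rewrite power_sum_commute.
by apply: cvgB; [apply: cvgZr | apply: (cvg_comp _ _ (hS x)); apply: T_cont]; apply: hS.
Qed.

Lemma resolventP (l : R[i]) (S : X -> X) : is_resolvent T l S -> resolvent T l = S.
Proof.
move=> hS; apply/funext => x; rewrite /resolvent; case: xgetP => [S' _ hS'|/(_ S)//].
by have [_ _ h1 _] := hS'; have [_ _ _ h2] := hS; rewrite -{1}(h2 x) h1.
Qed.

Lemma uniformly_Kreiss_Kreiss : uniformly_Kreiss_bounded beta T -> Kreiss_bounded beta T.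
Proof.
move=> hU.
have hres l : 1 < rnorm l -> exists2 S, is_resolvent T l S &
    forall x, (fun n => power_sum T (fun j => (l ^+ j.+1)^-1) n x) @ \oo --> S x.
  move=> l1; have l0 : 0 < rnorm l by apply: lt_trans l1.
  (* The spectrum requires all |l| > 1, while the growth bound needs rho < 2; this midpoint lies
     below both |l| and 2. *)
  pose rho := (1 + Num.min (rnorm l) 2) / 2.
  have rho1 : 1 < rho < 2.
    by rewrite /rho; case: (leP (rnorm l) 2) => ?; apply/andP; split; lra.
  have rhol : rho < rnorm l by rewrite /rho; case: (leP (rnorm l) 2) => ?; lra.
  have [M hM] := uniform_Kreiss_iter_growth hU rho1.
  apply: (@neumann_resolvent l M (rho / rnorm l)) => //.
    have /andP[/ltW/(le_trans ler01) rho0 _] := rho1.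
    by rewrite ltr_pdivrMr// mul1r rhol divr_ge0 ?rnorm_ge0.
  by rewrite divfK ?gt_eqF.
have [C C0 hC] := hU; split.
  move=> l /= hl; rewrite leNgt; apply/negP => l1; apply: hl.
  by have [S hS _] := hres _ l1; exists S.
exists C => // l l12; have /andP[l1 _] := l12.
have [S hS Scvg] := hres _ l1; rewrite (resolventP hS).
apply: opnorm_le => [|x]; first by rewrite divr_ge0 ?powR_ge0// ltW.
apply: (rnorm_lim_le (Scvg x)) => -[//|[//|n]] _.
apply: le_trans (rnorm_power_sum_le T_cont _ _ _) _.
by rewrite ler_wpM2r ?rnorm_ge0// -neumann_sumE hC.
Qed.

End UniformKreissToKreiss.

(** * From (3) to (1) *)

Section KreissToCesaro.
Local Open Scope complex_scope.
Context (R : realType) (X : complexBanachLattice R) (T : {linear X -> X}).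
Local Notation embed := (@cbl_embed R X).
Hypotheses (T_cont : continuous T) (T_pos : positive_op T).

Lemma Kreiss_C1 (beta : R) : 0 <= beta -> Kreiss_bounded beta T -> C1_bounded beta T.
Proof.
move=> beta_ge0 [hspec [C C0 hC]]; have [TE TE_ge0 TEP] := positive_op_real T_pos.
have hres (mu : R) : 1 < mu -> exists S, is_resolvent T mu%:C S.
  move=> mu1; apply: contrapT => hn; have := hspec mu%:C hn => /=.
  by rewrite rnorm_real gtr0_norm ?(lt_trans _ mu1)// leNgt mu1.
have bounded_res (mu : R) S : is_resolvent T mu%:C S ->
    (forall x, rnorm (S x) <= opnorm S * rnorm x).
  move=> [S_lin S_cont _ _] x.
  pose Sl : {linear X -> X} := HB.pack S (GRing.isLinear.Build _ _ _ _ S S_lin).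
  have [K K0 hK] := @linear_bounded _ _ Sl S_cont.
  by apply: (@rnorm_le_opnorm _ _ S K) => // c y; apply: (linearZZ Sl).
have embedT (mu : R) (u : cbl_real X) :
    embed (mu *: u - TE u) = mu%:C *: embed u - T (embed u).
  by rewrite embedB cbl_embedZ TEP.
have inv_le (mu : R) S u : is_resolvent T mu%:C S ->
    `|u| <= opnorm S * `|mu *: u - TE u|.
  move=> hS; rewrite -!rnorm_embed embedT.
  by have [_ _ h _] := hS; rewrite -{1}[embed u]h; apply: bounded_res hS _.
have surj (mu : R) : 1 < mu -> forall x, exists u, mu *: u - TE u = x.
  (* The real part [a] of the complex solution solves the real equation, since T preserves real and
     imaginary parts. *)
  move=> /hres[S [_ _ _ hS]] x; have [a [b ab]] := decomp_ex (S (embed x)).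
  exists a; have := hS (embed x); rewrite ab (linearD T) (linearZZ T) !TEP => hab.
  have [] // := @decomp_inj _ X (mu *: a - TE a) (mu *: b - TE b) x 0.
  rewrite embed0 scaler0 addr0 -hab !embedB !cbl_embedZ.
  by rewrite !scalerDr opprD scalerN addrACA !scalerA ['i * _]mulrC.
have pos : forall mu : R, 1 < mu -> inverse_positive TE mu.
  have [M _ hM] := linear_bounded T_cont.
  apply: (@inverse_positive_gt1 _ _ _ TE_ge0 M) => //.
    by move=> x; rewrite -!rnorm_embed -TEP.
  by move=> mu /hres[S hS]; exists (opnorm S) => u; apply: inv_le.
(* The factor e bounds (1 + 1/(n+1))^(n+1), and 2^beta comes from n + 1 <= 2n. *)
exists (expR 1 * (C * 2 `^ beta)) => [|n n0].
  by rewrite mulr_gt0 ?expR_gt0// mulr_gt0// powR_gt0.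
rewrite sum_iterE; apply: opnorm_le => [|z].
  by rewrite !mulr_ge0 ?expR_ge0 ?powR_ge0// ltW.
have [m [m0 mE hm]] := modulus_ex TE_ge0 TEP z.
apply: le_trans (hm _ _) _; rewrite -mE.
(* As n >= 1, h < 1 and r < 2, so the Kreiss bound applies at [r]. *)
pose h : R := n.+1%:R^-1; pose r := 1 + h.
have h0 : 0 < h by rewrite invr_gt0.
have h1 : h < 1 by rewrite invf_lt1// ltr1n ltnS.
have r1 : 1 < r by rewrite ltrDl.
have [v vE] := surj r r1 m.
have [S hS] := hres r r1.
have vle : `|v| <= C / h `^ beta * `|m|.
  apply: le_trans (inv_le _ _ v hS) _; rewrite vE ler_wpM2r//.
  have rn : rnorm r%:C = r by rewrite rnorm_real gtr0_norm// (lt_trans _ r1).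
  have := hC r%:C; rewrite rn (resolventP hS) {3}/r addrAC subrr add0r; apply.
  by rewrite r1/= /r; lra.
have -> : \sum_(j < n.+1) rnorm (1 : R[i]) *: iter j TE m = \sum_(j < n.+1) iter j TE m.
  apply: eq_bigr => j _; have -> : rnorm (1 : R[i]) = 1 by rewrite rnorm_real normr1.
  by rewrite scale1r.
have := @partial_sum_norm_le _ _ _ TE_ge0 r v n.+1 r1 (pos r r1).
rewrite vE => /(_ m0) /le_trans; apply.
rewrite -!mulrA; apply: ler_pM => //; first by rewrite exprn_ge0// ltW// (lt_trans _ r1).
  have -> : expR 1 = expR h ^+ n.+1 :> R by rewrite -expRM_natl mulfV.
  by rewrite ler_pXn2r ?nnegrE ?expR_ge0 ?expR_ge1Dx// ltW// (lt_trans _ r1).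
apply: le_trans vle _; rewrite !mulrA ler_wpM2r//.
rewrite -mulrA ler_wpM2l ?(ltW C0)//.
have -> : (h `^ beta)^-1 = n.+1%:R `^ beta.
  by rewrite -powRN /h -powR_inv1// -powRrM mulN1r opprK.
rewrite -powRM//; apply: ge0_ler_powR; rewrite ?nnegrE ?mulr_ge0//.
by rewrite -natrM ler_nat mul2n -addnn -addn1 leq_add2l.
Qed.

End KreissToCesaro.

Theorem proposition5p11 (R : realType) (X : complexBanachLattice R)
    (T : {linear X -> X}) (beta : R) :
  continuous T -> positive_op T -> 1 <= beta ->
  (C1_bounded beta T <-> uniformly_Kreiss_bounded beta T) /\
  (uniformly_Kreiss_bounded beta T <-> Kreiss_bounded beta T).
Proof.
move=> T_cont T_pos beta1.
have h12 := @C1_uniformly_Kreiss _ _ _ T_cont T_pos _ beta1.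
have h23 := @uniformly_Kreiss_Kreiss _ _ T beta T_cont.
have h31 := @Kreiss_C1 _ _ _ T_cont T_pos _ (le_trans ler01 beta1).
by split; split; auto.
Qed.
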